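(* Let $N\ge 1$. The map $\boldsymbol{f}:\mathcal{U}(N)\to\mathbb{R}^{N^2}$, $\boldsymbol{f}(\boldsymbol{U})=\boldsymbol{U}_{\mathcal{B}}^{\mathrm{H}}\,\mathrm{vec}(\log(\boldsymbol{U}))$, where $\log$ is the principal logarithm of a unitary matrix and $\boldsymbol{U}_{\mathcal{B}}$ is the matrix of vectorized basis elements of $\mathfrak{u}(N)$ (both defined in the context), is injective, and its inverse on its image is given by $\boldsymbol{\alpha}\mapsto\exp\big(\mathrm{vec}^{-1}(\boldsymbol{U}_{\mathcal{B}}\boldsymbol{\alpha})\big)$; that is, for every $\boldsymbol{U}\in\mathcal{U}(N)$, $$\exp\big(\mathrm{vec}^{-1}(\boldsymbol{U}_{\mathcal{B}}\,\boldsymbol{f}(\boldsymbol{U}))\big)=\boldsymbol{U}.$$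
   Context: $\mathcal{U}(N)$ is the group of $N\times N$ complex unitary matrices, and $\mathfrak{u}(N)=\{\boldsymbol{X}\in\mathbb{C}^{N\times N}:\boldsymbol{X}^{\mathrm{H}}+\boldsymbol{X}=\mathbf{0}\}$ is the real vector space of skew-Hermitian matrices. $\mathrm{j}$ is the imaginary unit, $(\cdot)^{\mathrm{H}}$ is conjugate transpose, $\exp$ is the matrix exponential, $\mathrm{vec}(\cdot)$ stacks the columns of an $N\times N$ matrix into a vector of length $N^2$, and $\mathrm{vec}^{-1}$ is its inverse. Principal logarithm: for $\boldsymbol{U}\in\mathcal{U}(N)$ take a unitary diagonalization $\boldsymbol{U}=\boldsymbol{Q}\,\mathrm{diag}(e^{\mathrm{j}\varphi_1},\dots,e^{\mathrm{j}\varphi_N})\,\boldsymbol{Q}^{\mathrm{H}}$ with $\boldsymbol{Q}$ unitary and $\varphi_n\in(-\pi,\pi]$ for all $n$, and set $\log(\boldsymbol{U})=\boldsymbol{Q}\,\mathrm{diag}(\mathrm{j}\varphi_1,\dots,\mathrm{j}\varphi_N)\,\boldsymbol{Q}^{\mathrm{H}}\in\mathfrak{u}(N)$ (this does not depend on the chosen diagonalization). Basis: let $\boldsymbol{E}_{k,l}$ be the $N\times N$ matrix with a $1$ in position $(k,l)$ and zeros elsewhere. Enumerate the pairs $(k,l)$ with $1\le k<l\le N$ by traversing the strictly upper triangular part row by row, and denote the $m$-th pair by $(k(m),l(m))$, $m=1,\dots,N(N-1)/2$. Define - $\boldsymbol{B}_1=\frac{\mathrm{j}}{\sqrt{N}}\mathbf{I}_N$;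 - $\boldsymbol{B}_n=\frac{\mathrm{j}}{\sqrt{n(n-1)}}\left(\sum_{i=1}^{n-1}\boldsymbol{E}_{i,i}-(n-1)\boldsymbol{E}_{n,n}\right)$ for $n=2,\dots,N$; - $\boldsymbol{B}_n=\frac{\mathrm{j}}{\sqrt{2}}\left(\boldsymbol{E}_{k(n'),l(n')}+\boldsymbol{E}_{l(n'),k(n')}\right)$ for $n=N+1,\dots,\frac{N(N+1)}{2}$, with $n'=n-N$; - $\boldsymbol{B}_n=\frac{1}{\sqrt{2}}\left(\boldsymbol{E}_{k(n''),l(n'')}-\boldsymbol{E}_{l(n''),k(n'')}\right)$ for $n=\frac{N(N+1)}{2}+1,\dots,N^2$, with $n''=n-\frac{N(N+1)}{2}$. These matrices form an orthonormal basis of the real vector space $\mathfrak{u}(N)$ for the inner product $\langle\boldsymbol{A},\boldsymbol{B}\rangle=\mathrm{trace}(\boldsymbol{A}^{\mathrm{H}}\boldsymbol{B})$. Set $\boldsymbol{U}_{\mathcal{B}}=[\mathrm{vec}(\boldsymbol{B}_1),\dots,\mathrm{vec}(\boldsymbol{B}_{N^2})]$, an $N^2\times N^2$ matrix. *)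

(* Defs.v *)
From HB Require Import structures.
From mathcomp Require Import all_boot all_order all_algebra.
From mathcomp Require Import all_classical all_reals all_analysis.
From mathcomp Require Import complex.

Set Implicit Arguments.
Unset Strict Implicit.
Unset Printing Implicit Defensive.

Import Order.TTheory GRing.Theory Num.Theory.
Import numFieldNormedType.Exports.

Local Open Scope classical_set_scope.
Local Open Scope ring_scope.
Local Open Scope sesquilinear_scope.

(* The limits below are taken in the topology of the abstract number field C;
   on matrices it is the entrywise topology. *)

Definition expC {C : numFieldType} (z : C) : C :=
  limn (series (fun k : nat => k`!%:R^-1 * z ^+ k)).

Definition expmx {C : numFieldType} {N : nat} (X : 'M[C]_N) : 'M[C]_N :=
  limn (series (fun k : nat => k`!%:R^-1 *: X ^+ k)).

(* mxvec is row-major, hence the transpositions: vec stacks columns. *)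
Definition vec {T : Type} {N : nat} (A : 'M[T]_N) : 'cV[T]_(N * N) :=
  (mxvec A^T)^T.

Definition unvec {T : Type} {N : nat} (v : 'cV[T]_(N * N)) : 'M[T]_N :=
  (vec_mx v^T)^T.

Section Basis.
Variables (C : numClosedFieldType) (N : nat).

(* Row, column and basis indices are 1-based in this section. *)

Definition elem_mx (k l : nat) : 'M[C]_N :=
  \matrix_(i, j) ((i.+1 == k) && (j.+1 == l))%:R.

Definition upper_pairs : seq (nat * nat) :=
  [seq (k, l) | k <- iota 1 N, l <- iota k.+1 (N - k)].

Definition upper_pair (m : nat) : nat * nat :=
  nth (0, 0)%N upper_pairs m.-1.

Definition uN_basis (n : nat) : 'M[C]_N :=
  if n == 1%N then ('i / sqrtC N%:R) *: 1%:M
  else if (n <= N)%N then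
    ('i / sqrtC (n * n.-1)%:R) *:
      (\sum_(1 <= i < n) elem_mx i i - n.-1%:R *: elem_mx n n)
  else if (n <= (N * N.+1)./2)%N then
    let: (k, l) := upper_pair (n - N) in
    ('i / sqrtC 2%:R) *: (elem_mx k l + elem_mx l k)
  else
    let: (k, l) := upper_pair (n - (N * N.+1)./2) in
    (1 / sqrtC 2%:R) *: (elem_mx k l - elem_mx l k).

Definition uN_basis_mx : 'M[C]_(N * N) :=
  \matrix_(p, q) vec (uN_basis q.+1) p 0.

End Basis.

Section PrincipalLog.
Variables (R : realType) (N : nat).

Definition is_principal_log (U L : 'M[R[i]]_N) : Prop :=
  exists (Q : 'M[R[i]]_N) (phi : 'rV[R]_N),
    [/\ Q \is unitarymx,
        forall n, - pi < phi 0 n <= pi,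
        U = Q *m diag_mx (map_mx (fun t => expC ('i * t%:C%C)) phi) *m Q ^t*
      & L = Q *m diag_mx (map_mx (fun t => 'i * t%:C%C) phi) *m Q ^t* ].

(* For unitary U exactly one L satisfies is_principal_log U L; for other
   matrices there is none and the value is 0. *)
Definition principal_log (U : 'M[R[i]]_N) : 'M[R[i]]_N :=
  xget 0 [set L | is_principal_log U L].

End PrincipalLog.

Section Coordinates.
Variables (R : realType) (N : nat).

Definition log_coordC (U : 'M[R[i]]_N) : 'cV[R[i]]_(N * N) :=
  (uN_basis_mx R[i] N) ^t* *m vec (principal_log U).

(* A real vector by construction; that taking real parts loses nothing on
   unitary matrices is part of the theorem. *)
Definition log_coord (U : 'M[R[i]]_N) : 'cV[R]_(N * N) :=
  map_mx (@complex.Re R) (log_coordC U).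

Definition exp_coord (alpha : 'cV[R]_(N * N)) : 'M[R[i]]_N :=
  expmx (unvec (uN_basis_mx R[i] N *m map_mx (real_complex R) alpha)).

End Coordinates.

(* Main.v *)
(* The basis matrices are orthonormal, so U_B is a square unitary matrix and
   alpha |-> U_B alpha undoes L |-> U_B^H vec L: exponentiating gives back
   exp (log U) = U, and injectivity follows. The coordinates are real because
   tr (A^H B) is real for skew-Hermitian A and B.  The spectral theorem
   provides log U; that exp (log U) = U reduces, after diagonalization, to the
   entrywise convergence of the series of exp (i t) = cos t + i sin t. *)
Require Import Defs.
From mathcomp Require Import all_boot all_order all_algebra.
From mathcomp Require Import all_classical all_reals all_analysis.
From mathcomp Require Import complex zify ring.
Set Implicit Arguments.
Unset Strict Implicit.
Unset Printing Implicit Defensive.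
Import Order.TTheory GRing.Theory Num.Theory.
Import numFieldNormedType.Exports.

Local Open Scope classical_set_scope.
Local Open Scope ring_scope.
Local Open Scope sesquilinear_scope.

(** * The exponential series on the imaginary axis, and arguments of unit complex numbers *)

Section ComplexExponential.
Variable R : realType.
(* R[i] carries its topology only when seen as a numFieldType. *)
Local Notation C := (Num.NumField.sort (R[i] : numFieldType)).

(** Positive elements of [R[i]] are real, so a radius in [R[i]] is already a radius in [R], and the
    modulus of a real number is its absolute value. *)
Lemma cvg_real_complex (u : nat -> R) (l : R) :
  u n @[n --> \oo] --> l ->
  (u n)%:C%C @[n --> \oo] --> (l%:C%C : C).
Proof.
move=> ul; apply/(@cvgrPdist_lt C C) => -[e f].
rewrite ltcE/= => /andP[ef e0]; have [f0|f0] := eqVneq f 0; last first.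
  by move: ef; rewrite (negPf f0).
near=> n; rewrite f0 -raddfB normc_def/= expr0n/= addr0 sqrtr_sqr ltcR.
by near: n; move/(@cvgrPdist_lt R R): ul; apply.
Unshelve. all: by end_near.
Qed.

(** Split by the parity of [k]: even powers of ['i] are signs, and on each parity class one of
    [cos_coeff], [sin_coeff] vanishes. *)
Lemma exp_coeff_i (t : R) (k : nat) :
  k`!%:R^-1 * ('i * t%:C%C) ^+ k
  = (cos_coeff t k)%:C%C + 'i * (sin_coeff t k)%:C%C :> R[i].
Proof.
rewrite exprMn -(odd_double_half k) /cos_coeff /sin_coeff /= oddD odd_double addbF.
rewrite exprD -mul2n exprM sqrCi.
case: (odd k) => /=; rewrite !(mul0r, mul1r, rmorph0, mulr0, add0r, addr0) mul2n ?add0n.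
  rewrite doubleK !rmorphM !rmorphXn rmorphN1 fmorphV rmorph_nat expr1.
  by rewrite mulrC -!mulrA.
rewrite doubleK -exprnP !rmorphM !rmorphXn rmorphN1 fmorphV rmorph_nat.
by rewrite mulrC -!mulrA.
Qed.

Lemma cvg_expC_i (t : R) :
  series (fun k : nat => k`!%:R^-1 * ('i * t%:C%C : C) ^+ k) n @[n --> \oo]
  --> ((cos t)%:C%C + 'i * (sin t)%:C%C : C).
Proof.
have -> : series (fun k : nat => k`!%:R^-1 * ('i * t%:C%C : C) ^+ k) =
  fun n => (series (cos_coeff t) n)%:C%C + 'i * (series (sin_coeff t) n)%:C%C.
  apply/funext => n; rewrite /series/= !rmorph_sum mulr_sumr -big_split.
  by apply: eq_bigr => k _; rewrite exp_coeff_i.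
apply: cvgD.
  by apply: cvg_real_complex; rewrite unlock; exact: is_cvg_series_cos_coeff.
apply: cvgMr; apply: cvg_real_complex; rewrite unlock.
exact: is_cvg_series_sin_coeff.
Qed.

Lemma expC_i (t : R) : expC ('i * t%:C%C : C) = (cos t)%:C%C + 'i * (sin t)%:C%C.
Proof.
apply: cvg_lim (@cvg_expC_i t).
exact: norm_hausdorff.
Qed.

(** The angle is [acos x] on the closed upper half circle and [- acos x] on the open lower one,
    which sends -1 to [pi]. *)
Lemma unit_expC_i (z : C) : `|z| = 1 ->
  exists2 t : R, - pi < t <= pi & z = expC ('i * t%:C%C).
Proof.
case: z => x y; rewrite normc_def/= => -[/(congr1 (fun r => r ^+ 2))].
rewrite sqr_sqrtr ?addr_ge0 ?sqr_ge0// expr1n => xy1.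
have x1 : -1 <= x <= 1.
  by rewrite -ler_norml -(@expr_le1 _ 2)// real_normK ?num_real// -xy1 lerDl sqr_ge0.
have sq : Num.sqrt (1 - x ^+ 2) = `|y|.
  by rewrite -xy1 addrAC subrr add0r sqrtr_sqr.
have [y0|y0] := leP 0 y.
  exists (acos x).
    rewrite acos_lepi// andbT (lt_le_trans _ (acos_ge0 x1))// oppr_lt0 pi_gt0//.
  rewrite expC_i acosK ?in_itv//= sin_acos// sq ger0_norm//.
  by rewrite -complexiE [LHS]complexE.
exists (- acos x).
  rewrite ltrN2.
  (* At [x = -1] the circle equation gives [y = 0], contrary to [y < 0]; this keeps the angle
     strictly above [- pi]. *)
  have xN1 : -1 < x.
    rewrite lt_neqAle; case/andP: (x1) => -> _; rewrite andbT eq_sym.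
    apply: contra_eq_neq xy1 => ->.
    by rewrite sqrrN expr1n addrC -subr_eq0 addrK expf_neq0// lt_eqF.
  rewrite acos_ltpi ?xN1/=; last by case/andP: x1.
  by rewrite (le_trans _ (pi_ge0 R))// oppr_le0 acos_ge0.
rewrite expC_i cosN sinN acosK ?in_itv//= sin_acos// sq ltr0_norm// opprK.
by rewrite -complexiE [LHS]complexE.
Qed.

End ComplexExponential.

(** * Entrywise limits and the exponential of a diagonalized matrix *)

Section MatrixExponential.

(** A neighbourhood of a matrix contains a box of entrywise neighbourhoods, and a filter is closed
    under the finite intersection over the indices. *)
Lemma cvg_mx (T : topologicalType) (m n : nat) (I : Type) (F : set_system I)
    (f : I -> 'M[T]_(m, n)) (M : 'M[T]_(m, n)) : Filter F ->
  (forall i j, f x i j @[x --> F] --> M i j) -> f x @[x --> F] --> M.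
Proof.
move=> FF fM A [P PM PA]; apply: (@filterS _ F _ (fun x => forall i j, P i j (f x i j))).
  by move=> x; exact: PA.
by apply: filter_forall => i; apply: filter_forall => j; exact: fM.
Qed.

(** Coordinates are continuous, so inseparable matrices have inseparable, hence equal, entries. This
    lets [cvg_lim] evaluate the [limn] in [expmx]. *)
Lemma mx_hausdorff (C : numFieldType) (m n : nat) : hausdorff_space 'M[C]_(m, n).
Proof.
move=> A B AB; apply/matrixP => i j.
apply: (@norm_hausdorff C C) => X Y /(@coord_continuous C m n i j A) AX.
move=> /(@coord_continuous C m n i j B) BY.
by have [M [? ?]] := AB _ _ AX BY; exists (M i j).
Qed.

Lemma mulmx_diag_exp (C : pzRingType) (N : nat) (P Q : 'M[C]_N) (d : 'rV[C]_N) k :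
  P *m Q = 1%:M -> Q *m P = 1%:M ->
  (P *m diag_mx d *m Q) ^+ k = P *m diag_mx (map_mx (fun x => x ^+ k) d) *m Q.
Proof.
move=> PQ QP; elim: k => [|k IHk].
  rewrite expr0 (_ : diag_mx _ = 1%:M) ?mulmx1 ?PQ//.
  by apply/matrixP => i j; rewrite !mxE expr0.
rewrite exprS IHk -[LHS]/(_ *m _) !mulmxA; congr (_ *m _).
rewrite -(mulmxA _ Q P) QP mulmx1 -!mulmxA; congr (_ *m _).
by apply/matrixP => i j; rewrite mul_diag_mx !mxE mulrnAr exprS.
Qed.

(** Conjugation commutes with powers, so each entry of a partial sum is a fixed finite combination
    of scalar partial sums, and the limit passes through it. *)
Lemma expmx_diag (C : numFieldType) (N : nat) (P Q : 'M[C]_N) (d e : 'rV[C]_N) :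
  P *m Q = 1%:M ->
  (forall i, series (fun k => k`!%:R^-1 * d 0 i ^+ k) n @[n --> \oo] --> e 0 i) ->
  expmx (P *m diag_mx d *m Q) = P *m diag_mx e *m Q.
Proof.
move=> PQ de; have QP := mulmx1C PQ.
apply: cvg_lim; first exact: mx_hausdorff.
apply: cvg_mx => i j.
have limE : (P *m diag_mx e *m Q) i j = \sum_l P i l * e 0 l * Q l j.
  by rewrite mul_mx_diag mxE; under eq_bigr do rewrite mxE.
have termE k : (k`!%:R^-1 *: (P *m diag_mx d *m Q) ^+ k) i j =
    \sum_l P i l * (k`!%:R^-1 * d 0 l ^+ k) * Q l j.
  rewrite mulmx_diag_exp// mul_mx_diag mxE mxE mulr_sumr.
  by apply: eq_bigr => l _; rewrite !mxE mulrA mulrCA mulrA.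
have seriesE n : series (fun k : nat => k`!%:R^-1 *: (P *m diag_mx d *m Q) ^+ k) n i j =
    \sum_l P i l * series (fun k => k`!%:R^-1 * d 0 l ^+ k) n * Q l j.
  rewrite /series/= summxE (eq_bigr _ (fun k _ => termE k)).
  rewrite exchange_big; apply: eq_bigr => l _.
  by rewrite mulr_sumr mulr_suml.
rewrite limE (eq_cvg _ _ seriesE).
apply: cvg_big => [|l _]; first exact: add_continuous.
by apply: cvgMl; apply: cvgMr.
Qed.

End MatrixExponential.

(** * Enumeration of the strictly upper triangular positions *)

Section UpperPairs.
Variable N : nat.

Lemma size_upper_pairs : size (upper_pairs N) = 'C(N, 2).
Proof.
rewrite size_allpairs_dep sumnE big_map (iotaDl 1 0) big_map.
under eq_bigr => k _ do rewrite size_iota.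
have -> : iota 0 N = index_iota 0 N by rewrite /index_iota subn0.
(* Row lengths run down from [N - 1] to [0]; reversal turns them into the sum of the first [N]
   naturals. *)
rewrite big_nat_rev -bin2_sum.
by apply: eq_big_nat => k /andP[_ kN]; lia.
Qed.

Lemma upper_pairs_uniq : uniq (upper_pairs N).
Proof.
apply: allpairs_uniq_dep => [|k _|]; rewrite ?iota_uniq//.
by move=> [k l] [k' l'] _ _ /= [-> ->].
Qed.

Lemma upper_pairP m : (m < 'C(N, 2))%N ->
  exists k l : 'I_N, (k < l)%N /\ upper_pair N m.+1 = (k.+1, l.+1).
Proof.
rewrite -size_upper_pairs => /(mem_nth (0, 0)%N) /allpairsPdep[k [l []]].
rewrite !mem_iota /upper_pair /= => k1 kl ->.
have kN : (k.-1 < N)%N by lia.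
have lN : (l.-1 < N)%N by lia.
exists (Ordinal kN), (Ordinal lN) => /=; split; first by lia.
by congr pair; lia.
Qed.

Lemma upper_pair_inj m n : (m < 'C(N, 2))%N -> (n < 'C(N, 2))%N ->
  (upper_pair N m.+1 == upper_pair N n.+1) = (m == n).
Proof.
by move=> mT nT; rewrite /upper_pair nth_uniq ?size_upper_pairs ?upper_pairs_uniq.
Qed.

(** This and the next identity place the block boundaries: [N] diagonal elements, then two blocks of
    ['C(N, 2)]. *)
Lemma half_mulnS : (N * N.+1)./2 = (N + 'C(N, 2))%N.
Proof. by rewrite mulnC -(bin2 N.+1) binS bin1 addnC. Qed.

Lemma mulnn_bin2 : (N * N)%N = (N + 'C(N, 2) + 'C(N, 2))%N.
Proof. by have := mul_bin_diag N 1; rewrite bin1; case: N => //= n; nia. Qed.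

End UpperPairs.

(** * Closed forms of the three families of basis matrices *)

Section BasisShape.
Variables (C : numClosedFieldType) (N : nat).

Lemma elem_mxS (k l : 'I_N) : elem_mx C N k.+1 l.+1 = delta_mx k l.
Proof. by apply/matrixP => i j; rewrite !mxE !eqSS. Qed.

(** Squared length of the unnormalized diagonal, as [sum_diag_entry_sq] shows. *)
Definition diag_sqnorm n : nat := if n == 1%N then N else (n * n.-1)%N.

(* n is 1-based, j is 0-based. *)
Definition diag_entry n j : C :=
  if n == 1%N then 1 else (j.+1 < n)%:R - n.-1%:R * (j.+1 == n)%:R.

Definition diag_basis_mx n : 'M[C]_N :=
  ('i / sqrtC (diag_sqnorm n)%:R) *: diag_mx (\row_j diag_entry n j).

Definition sym_mx (k l : 'I_N) : 'M[C]_N :=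
  ('i / sqrtC 2) *: (delta_mx k l + delta_mx l k).

Definition asym_mx (k l : 'I_N) : 'M[C]_N :=
  (1 / sqrtC 2) *: (delta_mx k l - delta_mx l k).

Lemma uN_basis_diag n : (0 < n <= N)%N -> uN_basis C N n = diag_basis_mx n.
Proof.
rewrite /uN_basis /diag_basis_mx /diag_sqnorm /diag_entry => /andP[n0 nN].
case: eqP => [_|/eqP n1].
  by congr (_ *: _); apply/matrixP => i j; rewrite !mxE.
rewrite nN; congr (_ *: _); apply/matrixP => i j; rewrite !mxE summxE.
have [<-|ij] := eqVneq i j; last first.
  have ijS m : (i.+1 == m) && (j.+1 == m) = false.
    apply/negbTE; apply: contraNN ij => /andP[/eqP <-].
    by rewrite eqSS eq_sym.
  rewrite ijS mulr0 subr0 mulr0n big1// => m _.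
  by rewrite mxE ijS.
rewrite mulr1n andbb; congr (_ - _).
under eq_bigr do rewrite mxE andbb.
(* Only the summand of index [i.+1] is nonzero here, and it lies in the range exactly when
   [i.+1 < n]. *)
have [iN|iN] := ltnP i.+1 n.
  rewrite (bigD1_seq i.+1) ?iota_uniq ?mem_index_iota//= eqxx.
  by rewrite big1 ?addr0// => m; rewrite eq_sym => /negPf ->.
rewrite big_nat big1// => m /andP[_ mn]; rewrite gtn_eqF//.
exact: leq_trans mn iN.
Qed.

Lemma uN_basis_sym m : (m < 'C(N, 2))%N ->
  exists k l : 'I_N, [/\ (k < l)%N, upper_pair N m.+1 = (k.+1, l.+1) &
    uN_basis C N (N + m).+1 = sym_mx k l].
Proof.
move=> mT; have [k [l [kl klE]]] := upper_pairP mT; exists k, l; split=> //.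
(* An ordinal below [N] makes [N] positive, so the index is not 1. *)
have k_lt := ltn_ord k.
rewrite /uN_basis half_mulnS -addnS addKn klE !elem_mxS.
rewrite ifF; last by lia.
rewrite ifF; last by lia.
by rewrite ifT//; lia.
Qed.

Lemma uN_basis_asym m : (m < 'C(N, 2))%N ->
  exists k l : 'I_N, [/\ (k < l)%N, upper_pair N m.+1 = (k.+1, l.+1) &
    uN_basis C N (N + 'C(N, 2) + m).+1 = asym_mx k l].
Proof.
move=> mT; have [k [l [kl klE]]] := upper_pairP mT; exists k, l; split=> //.
have k_lt := ltn_ord k.
rewrite /uN_basis half_mulnS -addnS addKn klE !elem_mxS.
by rewrite !ifF//; lia.
Qed.

End BasisShape.

(** * Orthonormality of the basis for the trace inner product *)

Section Orthonormality.
Variables (C : numClosedFieldType) (N : nat).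
Implicit Types X Y : 'M[C]_N.

Local Notation dot X Y := (\tr (X ^t* *m Y)).

Lemma trmxC_dotE X Y : dot X Y = \sum_i \sum_j (X i j)^* * Y i j.
Proof.
rewrite exchange_big; apply: eq_bigr => i _; rewrite mxE.
by apply: eq_bigr => j _; rewrite !mxE.
Qed.

Lemma trmxC_dotC X Y : dot Y X = (dot X Y)^*.
Proof.
rewrite !trmxC_dotE rmorph_sum; apply: eq_bigr => i _.
by rewrite rmorph_sum; apply: eq_bigr => j _; rewrite rmorphM /= conjCK mulrC.
Qed.

(** Reduces every product with a [sym_mx] or [asym_mx] to two mirror entries of the other factor. *)
Lemma dot_delta_mx X (k l : 'I_N) : dot X (delta_mx k l) = (X k l)^*.
Proof.
rewrite trmxC_dotE (bigD1 k)//= (bigD1 l)//= !mxE !eqxx mulr1.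
rewrite big1 => [|j /negPf jl]; last by rewrite mxE jl andbF mulr0.
rewrite big1 ?addr0// => i /negPf ik; rewrite big1// => j _.
by rewrite mxE ik mulr0.
Qed.

Lemma dot_sym_mx X (k l : 'I_N) :
  dot X (sym_mx C k l) = 'i / sqrtC 2 * ((X k l)^* + (X l k)^*).
Proof.
by rewrite /sym_mx -scalemxAr mxtraceZ mulmxDr mxtraceD !dot_delta_mx.
Qed.

Lemma dot_asym_mx X (k l : 'I_N) :
  dot X (asym_mx C k l) = 1 / sqrtC 2 * ((X k l)^* - (X l k)^*).
Proof.
by rewrite /asym_mx -scalemxAr mxtraceZ mulmxBr raddfB /= !dot_delta_mx.
Qed.

Lemma conj_sqrtC_nat n : (sqrtC n%:R)^* = sqrtC n%:R :> C.
Proof. by rewrite geC0_conj// sqrtC_ge0 ler0n. Qed.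

Lemma sqrtC2_neq0 : sqrtC 2 != 0 :> C.
Proof. by rewrite sqrtC_eq0 pnatr_eq0. Qed.

Lemma diag_basis_mx_offdiag n (k l : 'I_N) : (k < l)%N ->
  (diag_basis_mx C N n k l = 0) * (diag_basis_mx C N n l k = 0).
Proof. by move=> kl; rewrite !mxE -!val_eqE /= (gtn_eqF kl) (ltn_eqF kl) !mulr0. Qed.

(** The orderings rule out a crossed match, so one matrix unit at most is seen at each position. The
    product of equations acts as one rewrite rule for an entry and its mirror. *)
Lemma sym_mxE (k l k' l' : 'I_N) : (k < l)%N -> (k' < l')%N ->
  (sym_mx C k l k' l' = 'i / sqrtC 2 * ((k == k') && (l == l'))%:R) *
  (sym_mx C k l l' k' = 'i / sqrtC 2 * ((k == k') && (l == l'))%:R).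
Proof.
move=> kl kl'; rewrite !mxE -!val_eqE /=.
have -> : (k' == l :> nat) && (l' == k :> nat) = false by lia.
have -> : (l' == k :> nat) && (k' == l :> nat) = false by lia.
by rewrite addr0 add0r (andbC (l' == _ :> nat)) (eq_sym (k' : nat)) (eq_sym (l' : nat)).
Qed.

Lemma asym_mxE (k l k' l' : 'I_N) : (k < l)%N -> (k' < l')%N ->
  (asym_mx C k l k' l' = 1 / sqrtC 2 * ((k == k') && (l == l'))%:R) *
  (asym_mx C k l l' k' = - (1 / sqrtC 2 * ((k == k') && (l == l'))%:R)).
Proof.
move=> kl kl'; rewrite !mxE -!val_eqE /=.
have -> : (k' == l :> nat) && (l' == k :> nat) = false by lia.
have -> : (l' == k :> nat) && (k' == l :> nat) = false by lia.
by rewrite subr0 sub0r mulrN (andbC (l' == _ :> nat)) (eq_sym (k' : nat)) (eq_sym (l' : nat)).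
Qed.

Lemma dot_sym_sym (k l k' l' : 'I_N) : (k < l)%N -> (k' < l')%N ->
  dot (sym_mx C k l) (sym_mx C k' l') = ((k == k') && (l == l'))%:R.
Proof.
move=> kl kl'; rewrite dot_sym_mx !(sym_mxE kl kl') !rmorphM /= conjCi conjC_nat.
rewrite fmorphV /=.
rewrite conj_sqrtC_nat.
have := sqrtC2_neq0; have := sqrtCK (2 : C); set s := sqrtC 2 => ss s0; set b := _%:R.
(* The two mirror entries give the factor 2, which the squared normalization cancels. *)
rewrite [LHS](_ : _ = - ('i * 'i) * b * (2 / s ^+ 2)); last by field.
by rewrite -expr2 sqrCi opprK mul1r ss divff ?pnatr_eq0// mulr1.
Qed.

Lemma dot_asym_asym (k l k' l' : 'I_N) : (k < l)%N -> (k' < l')%N ->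
  dot (asym_mx C k l) (asym_mx C k' l') = ((k == k') && (l == l'))%:R.
Proof.
move=> kl kl'; rewrite dot_asym_mx !(asym_mxE kl kl') rmorphN /= !rmorphM /= conjC1.
rewrite conjC_nat opprK.
rewrite fmorphV /=.
rewrite conj_sqrtC_nat.
have := sqrtC2_neq0; have := sqrtCK (2 : C); set s := sqrtC 2 => ss s0; set b := _%:R.
rewrite [LHS](_ : _ = b * (2 / s ^+ 2)); last by field.
by rewrite ss divff ?pnatr_eq0// mulr1.
Qed.

(** Equal mirror entries enter with opposite signs and cancel. *)
Lemma dot_sym_asym (k l k' l' : 'I_N) : (k < l)%N -> (k' < l')%N ->
  dot (sym_mx C k l) (asym_mx C k' l') = 0.
Proof. by move=> kl kl'; rewrite dot_asym_mx !(sym_mxE kl kl') subrr mulr0. Qed.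

Lemma dot_diag_sym n (k l : 'I_N) : (k < l)%N ->
  dot (diag_basis_mx C N n) (sym_mx C k l) = 0.
Proof. by move=> kl; rewrite dot_sym_mx !(diag_basis_mx_offdiag n kl) conjC0 addr0 mulr0. Qed.

Lemma dot_diag_asym n (k l : 'I_N) : (k < l)%N ->
  dot (diag_basis_mx C N n) (asym_mx C k l) = 0.
Proof. by move=> kl; rewrite dot_asym_mx !(diag_basis_mx_offdiag n kl) conjC0 subrr mulr0. Qed.

(** The diagonal is [n.-1] ones, then [- n.-1], then zeros. The length [M] is free because the lemma
    serves both for [N] and for a sum truncated at [n.-1]. *)
Lemma sum_diag_entry M n (f : nat -> C) : (1 < n <= M)%N ->
  \sum_(j < M) diag_entry C n j * f j =
  \sum_(0 <= j < n.-1) f j - n.-1%:R * f n.-1.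
Proof.
move=> /andP[n1 nN]; rewrite -(big_mkord xpredT (fun j => diag_entry C n j * f j)).
rewrite (big_cat_nat (leq0n n) nN)//= [X in _ + X]big_nat [X in _ + X]big1 ?addr0; last first.
  move=> j /andP[nj _]; rewrite /diag_entry ifF; last by lia.
  have -> : (j.+1 < n)%N = false by lia.
  have -> : (j.+1 == n) = false by lia.
  by rewrite mulr0 subr0 mul0r.
case: n n1 nN => // n n1 nN; rewrite big_nat_recr//=; congr (_ + _); last first.
  rewrite /diag_entry ifF; last by lia.
  by rewrite ltnn eqxx mulr1 sub0r mulNr.
apply: eq_big_nat => j /andP[_ jn]; rewrite /diag_entry ifF; last by lia.
by rewrite !eqSS ltnS jn (ltn_eqF jn) mulr0 subr0 mul1r.
Qed.

Lemma sum_diag_entry_sq n : (0 < n <= N)%N ->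
  \sum_(j < N) diag_entry C n j * diag_entry C n j = (diag_sqnorm N n)%:R.
Proof.
move=> /andP[n0 nN]; have [n1|n1] := eqVneq n 1%N.
  rewrite /diag_sqnorm n1 eqxx -[in RHS](card_ord N) -sum1_card natr_sum.
  by apply: eq_bigr => j _; rewrite /diag_entry eqxx mulr1.
have n1' : (1 < n)%N by lia.
rewrite sum_diag_entry ?n1'// /diag_sqnorm (negPf n1).
rewrite (eq_big_nat _ _ (F2 := fun=> 1)) => [|j /andP[_ jn]]; last first.
  rewrite /diag_entry (negPf n1) (_ : (j.+1 < n)%N); last by lia.
  by rewrite ltn_eqF ?mulr0 ?subr0//; lia.
rewrite /diag_entry (negPf n1) (prednK n0) ltnn eqxx mulr1 sub0r mulrN opprK.
(* What remains is (n - 1) + (n - 1)^2 = n(n - 1). *)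
rewrite sumr_const_nat subn0 -natrM -natrD; congr _%:R.
by case: n {nN n1 n1'} n0 => // n _; rewrite mulSn.
Qed.

(** For [m > 1], diagonal [n] is constantly 1 on the support of diagonal [m], whose entries sum to
    zero; for [m = 1] the entries of diagonal [n] themselves sum to zero. *)
Lemma sum_diag_entry_ortho m n : (0 < m < n)%N -> (n <= N)%N ->
  \sum_(j < N) diag_entry C n j * diag_entry C m j = 0.
Proof.
move=> /andP[m0 mn] nN; have n1 : (1 < n)%N by lia.
rewrite sum_diag_entry ?n1//; have [->|m1] := eqVneq m 1%N.
  rewrite /diag_entry eqxx (eq_bigr (fun=> 1))// sumr_const_nat subn0.
  by rewrite mulr1 subrr.
have m1' : (1 < m)%N by lia.
rewrite {2}/diag_entry (negPf m1) prednK ?(ltn_trans m0)// ltnNge (ltnW mn).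
rewrite (gtn_eqF mn) mulr0 subr0 mulr0 subr0.
under eq_big_nat => j _ do rewrite -[diag_entry _ _ _]mulr1.
rewrite big_mkord (sum_diag_entry (fun=> 1)) ?m1'/=; last by lia.
by rewrite sumr_const_nat subn0 mulr1 subrr.
Qed.

Lemma diag_entry_real n j : (diag_entry C n j)^* = diag_entry C n j.
Proof.
by rewrite /diag_entry; case: ifP => _; rewrite ?conjC1// rmorphB /= rmorphM /= !conjC_nat.
Qed.

Lemma dot_diag m n : dot (diag_basis_mx C N m) (diag_basis_mx C N n) =
  (sqrtC (diag_sqnorm N m)%:R * sqrtC (diag_sqnorm N n)%:R)^-1 * 
  \sum_(j < N) diag_entry C n j * diag_entry C m j.
Proof.
rewrite trmxC_dotE mulr_sumr; apply: eq_bigr => i _.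
rewrite (bigD1 i)//= big1 ?addr0 => [|j ij]; last first.
  by rewrite !mxE eq_sym (negPf ij) !mulr0.
rewrite !mxE eqxx !mulr1n !rmorphM /= conjCi fmorphV /= conj_sqrtC_nat diag_entry_real.
set a := sqrtC _; set b := sqrtC _; set x := diag_entry _ _ _; set y := diag_entry _ _ _.
rewrite invfM (_ : _ * _ = - ('i * 'i) * (a^-1 * b^-1 * (y * x))); last by ring.
by rewrite -expr2 sqrCi opprK mul1r.
Qed.

Lemma dot_diag_diag m n : (0 < m <= N)%N -> (0 < n <= N)%N ->
  dot (diag_basis_mx C N m) (diag_basis_mx C N n) = (m == n)%:R.
Proof.
have dot_lt a b : (0 < a < b)%N -> (b <= N)%N ->
    dot (diag_basis_mx C N a) (diag_basis_mx C N b) = 0.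
  by move=> ab bN; rewrite dot_diag sum_diag_entry_ortho// mulr0.
move=> /andP[m0 mN] /andP[n0 nN].
case: (ltngtP m n) => [mn|nm|<-]; first by rewrite dot_lt ?m0.
  by rewrite trmxC_dotC dot_lt ?conjC0// n0.
rewrite dot_diag sum_diag_entry_sq ?m0// -expr2 sqrtCK mulVf// pnatr_eq0.
by rewrite /diag_sqnorm; case: (eqVneq m 1%N) => m1; rewrite ?muln_eq0; lia.
Qed.

Lemma uN_basis_orthonormal m n : (0 < m <= N * N)%N -> (0 < n <= N * N)%N ->
  dot (uN_basis C N m) (uN_basis C N n) = (m == n)%:R.
Proof.
(* The enumeration has no repetition, so equal positions mean equal offsets within a block. *)
have pair_eq m1 n1 (k l k' l' : 'I_N) : (m1 < 'C(N, 2))%N -> (n1 < 'C(N, 2))%N ->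
    upper_pair N m1.+1 = (k.+1, l.+1) -> upper_pair N n1.+1 = (k'.+1, l'.+1) ->
    (k == k') && (l == l') = (m1 == n1).
  by move=> mT nT mE nE; rewrite -(upper_pair_inj mT nT) mE nE.
have shape n1 : (0 < n1 <= N * N)%N ->
    [\/ (n1 <= N)%N,
        exists2 m1, (m1 < 'C(N, 2))%N & n1 = (N + m1).+1
      | exists2 m1, (m1 < 'C(N, 2))%N & n1 = (N + 'C(N, 2) + m1).+1].
  rewrite mulnn_bin2 => n1N.
  have [|Nn] := leqP n1 N; first by constructor 1.
  have [nT|Tn] := leqP n1 (N + 'C(N, 2)).
    by constructor 2; exists (n1 - N.+1)%N; lia.
  by constructor 3; exists (n1 - (N + 'C(N, 2)).+1)%N; lia.
move=> mN nN; have [m0 n0] : (0 < m)%N /\ (0 < n)%N by lia.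
have [m1|[m1 m1T mE]|[m1 m1T mE]] := shape m mN;
  have [n1|[n1 n1T nE]|[n1 n1T nE]] := shape n nN.
- by rewrite !uN_basis_diag ?m0 ?n0// dot_diag_diag ?m0 ?n0.
- have [k [l [kl _ klE]]] := uN_basis_sym C n1T.
  rewrite nE klE uN_basis_diag ?m0// dot_diag_sym//.
  by rewrite (_ : _ == _ = false)//; lia.
- have [k [l [kl _ klE]]] := uN_basis_asym C n1T.
  rewrite nE klE uN_basis_diag ?m0// dot_diag_asym//.
  by rewrite (_ : _ == _ = false)//; lia.
- have [k [l [kl _ klE]]] := uN_basis_sym C m1T.
  rewrite mE klE trmxC_dotC uN_basis_diag ?n0// dot_diag_sym// conjC0.
  by rewrite (_ : _ == _ = false)//; lia.
- have [k [l [kl pE klE]]] := uN_basis_sym C m1T.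
  have [k' [l' [kl' pE' klE']]] := uN_basis_sym C n1T.
  rewrite mE nE klE klE' dot_sym_sym// (pair_eq m1 n1)//.
  by rewrite eqSS eqn_add2l.
- have [k [l [kl pE klE]]] := uN_basis_sym C m1T.
  have [k' [l' [kl' pE' klE']]] := uN_basis_asym C n1T.
  rewrite mE nE klE klE' dot_sym_asym//.
  by rewrite (_ : _ == _ = false)//; lia.
- have [k [l [kl _ klE]]] := uN_basis_asym C m1T.
  rewrite mE klE trmxC_dotC uN_basis_diag ?n0// dot_diag_asym// conjC0.
  by rewrite (_ : _ == _ = false)//; lia.
- have [k [l [kl pE klE]]] := uN_basis_asym C m1T.
  have [k' [l' [kl' pE' klE']]] := uN_basis_sym C n1T.
  rewrite mE nE klE klE' trmxC_dotC dot_sym_asym// conjC0.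
  by rewrite (_ : _ == _ = false)//; lia.
- have [k [l [kl pE klE]]] := uN_basis_asym C m1T.
  have [k' [l' [kl' pE' klE']]] := uN_basis_asym C n1T.
  rewrite mE nE klE klE' dot_asym_asym// (pair_eq m1 n1)//.
  by rewrite eqSS eqn_add2l.
Qed.

Lemma trmxC_vec_mul X Y : ((vec X) ^t* *m vec Y) 0 0 = dot X Y.
Proof.
(* The exchange puts columns outermost, the order in which [vec] lists the entries. *)
rewrite trmxC_dotE mxE exchange_big /= pair_bigA/=.
rewrite (reindex _ (curry_mxvec_bij N N)) /=.
by apply: eq_bigr => -[i j] _; rewrite !mxE !mxvecE !mxE.
Qed.

Lemma uN_basis_mx_unitary : uN_basis_mx C N \is unitarymx.
Proof.
have gram : (uN_basis_mx C N) ^t* *m uN_basis_mx C N = 1%:M.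
  apply/matrixP => p q.
  have -> : (1%:M : 'M[C]_(N * N)) p q =
      dot (uN_basis C N p.+1) (uN_basis C N q.+1).
    by rewrite uN_basis_orthonormal ?ltn_ord//= eqSS mxE val_eqE.
  rewrite -trmxC_vec_mul [LHS]mxE [RHS]mxE; apply: eq_bigr => r _.
  by rewrite !mxE.
(* [unitarymx] asks for the product in the other order; for a square matrix a left inverse is a
   right inverse, so orthonormality yields completeness. *)
by apply/unitarymxP; exact: mulmx1C.
Qed.

End Orthonormality.

(** * The principal logarithm and its real coordinates *)

Section LogCoordinates.
Variables (R : realType) (N : nat).
Implicit Types U L : 'M[R[i]]_N.

Lemma unitarymx_diagP U : U \is unitarymx ->
  exists (Q : 'M[R[i]]_N) (d : 'rV[R[i]]_N),
    [/\ Q \is unitarymx, forall n, `|d 0 n| = 1 & U = Q *m diag_mx d *m Q ^t*].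
Proof.
move=> Uu; have /unitarymxP UU := Uu.
have /orthomx_spectralP UE : U \is normalmx.
  by apply/normalmxP; rewrite UU; apply/esym/mulmx1C.
set P := spectralmx U in UE; set d := spectral_diag U in UE.
have Pu : P \is unitarymx by exact: spectral_unitarymx.
have PP := unitarymxP Pu; have PP' := mulmx1C PP.
have PV : invmx P = P ^t*.
  by rewrite -[RHS]mul1mx -(mulVmx (unitarymx_unit Pu)) -mulmxA PP mulmx1.
exists (P ^t*), d; split=> [|n|].
(* The spectral theorem gives [U] as [invmx P *m diag_mx d *m P], hence the witness [P ^t*]. *)
- by apply/unitarymxP; rewrite trmxCK.
- have dE : diag_mx d = P *m U *m P ^t*.
    by rewrite UE PV !mulmxA PP mul1mx -mulmxA PP mulmx1.
  have /unitarymxP : diag_mx d \is unitarymx.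
    rewrite dE !mul_unitarymx//; apply/unitarymxP; rewrite trmxCK//.
  (* The diagonal factor is itself unitary, and its n-th diagonal equation says that the eigenvalue
     has squared modulus 1. *)
  move=> /matrixP/(_ n n); rewrite mul_diag_mx !mxE eqxx mulr1n -normCK => /eqP.
  by rewrite sqrp_eq1// => /eqP.
- by rewrite trmxCK -PV.
Qed.

(** [xget] returns a logarithm once one exists; one is built by choosing an angle for each
    eigenvalue. *)
Lemma principal_logP U : U \is unitarymx ->
  is_principal_log U (principal_log U).
Proof.
move=> /unitarymx_diagP[Q [d [Qu d1 UE]]]; apply: (@xgetPex _ 0 (is_principal_log U)).
have /choice[phi phiP] : forall n, exists t : R,
    - pi < t <= pi /\ d 0 n = expC ('i * t%:C%C).
  by move=> n; have [t] := unit_expC_i (d1 n); exists t.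
exists (Q *m diag_mx (map_mx (fun t => 'i * t%:C%C) (\row_n phi n)) *m Q ^t*).
exists Q, (\row_n phi n); split=> // [n|]; first by rewrite mxE; case: (phiP n).
rewrite UE; do 2 congr (_ *m _); congr diag_mx.
by apply/rowP => n; rewrite !mxE; case: (phiP n).
Qed.

Lemma expmx_principal_log U L : is_principal_log U L -> expmx L = U.
Proof.
move=> [Q [phi [/unitarymxP QQ _ -> ->]]]; apply: expmx_diag => // n.
by rewrite !mxE expC_i; exact: cvg_expC_i.
Qed.

Lemma principal_log_skew U L : is_principal_log U L -> L ^t* = - L.
Proof.
move=> [Q [phi [_ _ _ ->]]]; rewrite !trmx_mul !map_mxM /= trmxCK.
rewrite mulmxA -mulNmx -mulmxN; do 2 congr (_ *m _).
apply/matrixP => i j; rewrite !mxE eq_sym; have [<-|_] := eqVneq i j.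
  rewrite !mulr1n rmorphM /= conjCi mulNr; congr (- (_ * _)).
  by apply/CrealP/complex_realP; exists (phi 0 i).
by rewrite !mulr0n conjC0 oppr0.
Qed.

(** Each element is an imaginary multiple of a real symmetric matrix or a real multiple of a real
    antisymmetric one. *)
Lemma uN_basis_skew (C : numClosedFieldType) n :
  (uN_basis C N n) ^t* = - uN_basis C N n.
Proof.
have conj_i s : ('i / sqrtC s%:R : C)^* = - ('i / sqrtC s%:R).
  by rewrite rmorphM /= conjCi fmorphV /= conj_sqrtC_nat mulNr.
have conj_1 s : (1 / sqrtC s%:R : C)^* = 1 / sqrtC s%:R.
  by rewrite rmorphM /= conjC1 fmorphV /= conj_sqrtC_nat.
have trmxCZ a (A : 'M[C]_N) : (a *: A) ^t* = a^* *: A ^t*.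
  by apply/matrixP => i j; rewrite !mxE rmorphM.
have trmxCD (A B : 'M[C]_N) : (A + B) ^t* = A ^t* + B ^t*.
  by rewrite linearD map_mxD.
have trmxCN (A : 'M[C]_N) : (- A) ^t* = - A ^t* by rewrite linearN map_mxN.
have trmxC_elem k l : (elem_mx C N k l) ^t* = elem_mx C N l k.
  by apply/matrixP => i j; rewrite !mxE conjC_nat andbC.
rewrite /uN_basis; case: ifP => _; last case: ifP => _; last case: ifP => _.
- by rewrite trmxCZ conj_i scaleNr trmx1 map_mx1.
- rewrite trmxCZ conj_i scaleNr trmxCD trmxCN trmxCZ trmxC_elem conjC_nat.
  rewrite linear_sum map_mx_sum /=.
  by under eq_bigr do rewrite trmxC_elem.
- case: upper_pair => k l.
  by rewrite trmxCZ conj_i scaleNr trmxCD !trmxC_elem addrC.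
- case: upper_pair => k l.
  by rewrite trmxCZ conj_1 -scalerN trmxCD trmxCN !trmxC_elem opprB addrC.
Qed.

(** Conjugation swaps [X] and [Y]; skewness turns both traces into minus the trace of a product,
    which is cyclic. *)
Lemma trmxC_dot_skew_real (C : numClosedFieldType) (X Y : 'M[C]_N) :
  X ^t* = - X -> Y ^t* = - Y -> \tr (X ^t* *m Y) \is Num.real.
Proof.
move=> Xs Ys; apply/CrealP; rewrite -trmxC_dotC Xs Ys.
by rewrite !mulNmx !raddfN /= mxtrace_mulC.
Qed.

Lemma log_coordCE U p :
  log_coordC U p 0 = \tr ((uN_basis R[i] N p.+1) ^t* *m principal_log U).
Proof.
rewrite -trmxC_vec_mul [LHS]mxE [RHS]mxE; apply: eq_bigr => r _.
by rewrite !mxE.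
Qed.

Lemma log_coord_real U : U \is unitarymx ->
  map_mx (real_complex R) (log_coord U) = log_coordC U.
Proof.
move=> Uu; apply/matrixP => p j; rewrite !ord1 2!mxE RRe_real// log_coordCE.
apply: trmxC_dot_skew_real; first exact: uN_basis_skew.
exact: principal_log_skew (principal_logP Uu).
Qed.

Lemma vecK (T : Type) : cancel (@vec T N) unvec.
Proof. by move=> A; rewrite /vec /unvec trmxK mxvecK trmxK. Qed.

Lemma exp_coordK U : U \is unitarymx -> exp_coord (log_coord U) = U.
Proof.
move=> Uu; rewrite /exp_coord log_coord_real// /log_coordC mulmxA.
rewrite (unitarymxP (uN_basis_mx_unitary _ _)) mul1mx vecK.
exact: expmx_principal_log (principal_logP Uu).
Qed.

End LogCoordinates.

Theorem mainTheorem2 (R : realType) (N : nat) (N_ge1 : (1 <= N)%N) :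
  [/\ forall U : 'M[R[i]]_N, U \is unitarymx ->
        map_mx (real_complex R) (log_coord U) = log_coordC U,
      forall U V : 'M[R[i]]_N, U \is unitarymx -> V \is unitarymx ->
        log_coord U = log_coord V -> U = V,
      forall alpha : 'cV[R]_(N * N),
        (exists2 U : 'M[R[i]]_N, U \is unitarymx & log_coord U = alpha) ->
        exp_coord alpha \is unitarymx /\ log_coord (exp_coord alpha) = alpha
    & forall U : 'M[R[i]]_N, U \is unitarymx ->
        exp_coord (log_coord U) = U].
Proof.
split.
- exact: log_coord_real.
- by move=> U V Uu Vu UV; rewrite -(exp_coordK Uu) UV exp_coordK.
(* A point of the image is the coordinate vector of some unitary [U], and [exp_coord] returns that
   [U], which settles both claims. *)
- by move=> alpha [U Uu <-]; rewrite exp_coordK.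
- exact: exp_coordK.
Qed.
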